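(* Let $m,n\ge 2$. For every unitarily invariant norm $\|\cdot\|$ on $\mathbb{M}_n$ and all $A_1,\dots,A_m\in\mathbb{M}_n$, $$\Bigl\|\sum_{k=1}^m A_k\Bigr\|\ \le\ \sqrt{\min\{m,n\}}\,\Bigl\|\sum_{k=1}^m |A_k|\Bigr\|.$$ Moreover, the constant $\sqrt{\min\{m,n\}}$ is sharp: if $c$ is a real number such that $\|\sum_{k=1}^m A_k\|\le c\,\|\sum_{k=1}^m|A_k|\|$ for every unitarily invariant norm on $\mathbb{M}_n$ and all $A_1,\dots,A_m\in\mathbb{M}_n$, then $c\ge\sqrt{\min\{m,n\}}$.
   Context: $\mathbb{M}_n$ is the set of $n\times n$ complex matrices, $Z^*$ is the conjugate transpose of $Z$, and $|Z|:=(Z^*Z)^{1/2}$. A norm $\|\cdot\|$ on $\mathbb{M}_n$ is unitarily invariant if $\|UZV\|=\|Z\|$ for all $Z\in\mathbb{M}_n$ and all unitaries $U,V\in\mathbb{M}_n$. *)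

(* Defs.v *)
From HB Require Import structures.
From mathcomp Require Import all_boot all_order all_algebra.
From mathcomp Require Import complex.
From mathcomp Require Import reals.

Set Implicit Arguments.
Unset Strict Implicit.
Unset Printing Implicit Defensive.

Import Order.TTheory GRing.Theory Num.Theory.

Local Open Scope ring_scope.
Local Open Scope sesquilinear_scope.

Section AbsoluteValue.
Context {C : numClosedFieldType} {n : nat}.
Implicit Types A Z : 'M[C]_n.

Definition psdmx A : Prop :=
  A \is hermsymmx /\ forall v : 'rV[C]_n, 0 <= (v *m A *m v ^t*) 0 0.

(* By [orthomx_spectralP], a normal matrix [A] is
   [invmx (spectralmx A) *m diag_mx (spectral_diag A) *m spectralmx A] with
   [spectralmx A] unitary.  [sqrtmx A] is only meaningful for positive
   semidefinite [A]; see [sqrtmx_psd] and [sqr_sqrtmx]. *)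
Definition sqrtmx A : 'M[C]_n :=
  invmx (spectralmx A) *m diag_mx (map_mx sqrtC (spectral_diag A))
    *m spectralmx A.

Definition absmx Z : 'M[C]_n := sqrtmx (Z ^t* *m Z).

Lemma sqr_norm_ge0 m (w : 'rV[C]_m) : 0 <= (w *m w ^t*) 0 0.
Proof.
by rewrite mxE; apply: sumr_ge0 => i _; rewrite !mxE -normCK exprn_ge0.
Qed.

Lemma hermsymmxE A : (A \is hermsymmx) = (A == A ^t*).
Proof. by rewrite qualifE/= expr0 scale1r. Qed.

Lemma psdmx_gram Z : psdmx (Z ^t* *m Z).
Proof.
split.
  by rewrite hermsymmxE trmx_mul map_mxM trmxCK.
move=> v.
have -> : v *m (Z ^t* *m Z) *m v ^t* = (v *m Z ^t*) *m (v *m Z ^t*) ^t*.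
  by rewrite trmx_mul map_mxM trmxCK !mulmxA.
exact: sqr_norm_ge0.
Qed.

Lemma psd_spectralE A : psdmx A ->
  A = (spectralmx A) ^t* *m diag_mx (spectral_diag A) *m spectralmx A.
Proof.
move=> [hA _]; rewrite -(invmx_unitary (spectral_unitarymx A)).
exact/orthomx_spectralP/hermitian_normalmx.
Qed.

Lemma psd_spectral_diag_ge0 A i : psdmx A -> 0 <= spectral_diag A 0 i.
Proof.
move=> pA; have [_ /(_ (delta_mx 0 i *m spectralmx A))] := pA.
have /unitarymxP PP := spectral_unitarymx A.
rewrite {2}(psd_spectralE pA) trmx_mul map_mxM !mulmxA.
rewrite -(mulmxA _ (spectralmx A) (_ ^t*)) PP mulmx1.
rewrite -(mulmxA _ (spectralmx A) (_ ^t*)) PP mulmx1.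
rewrite -rowE row_diag_mx -scalemxAl mxE mxE (bigD1 i) //= big1 => [|j ji].
  by rewrite !mxE !eqxx addr0 /= conjC1 !mulr1.
by rewrite mxE (negPf ji) andbF mul0r.
Qed.

Lemma sqrtmx_psd A : psdmx A -> psdmx (sqrtmx A).
Proof.
move=> pA; rewrite /sqrtmx (invmx_unitary (spectral_unitarymx A)).
set P := spectralmx A.
set d := map_mx sqrtC _.
pose e := map_mx sqrtC d.
have e_ge0 i : 0 <= e 0 i.
  by rewrite mxE sqrtC_ge0 mxE sqrtC_ge0 psd_spectral_diag_ge0.
have -> : P ^t* *m diag_mx d *m P = (diag_mx e *m P) ^t* *m (diag_mx e *m P).
  rewrite trmx_mul map_mxM tr_diag_mx map_diag_mx -!mulmxA; congr (_ *m _).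
  rewrite !mulmxA mulmx_diag; congr (diag_mx _ *m _); apply/rowP => i.
  rewrite [RHS]mxE [X in _ = X * _]mxE.
  by rewrite [X in X * _](geC0_conj (e_ge0 i)) -expr2 [e _ _]mxE sqrtCK.
exact: psdmx_gram.
Qed.

Lemma sqr_sqrtmx A : psdmx A -> sqrtmx A *m sqrtmx A = A.
Proof.
move=> pA; rewrite [RHS]psd_spectralE // /sqrtmx.
rewrite (invmx_unitary (spectral_unitarymx A)).
have /unitarymxP PP := spectral_unitarymx A.
rewrite !mulmxA -(mulmxA _ (spectralmx A) (_ ^t*)) PP mulmx1.
rewrite -(mulmxA _ (diag_mx _) (diag_mx _)) mulmx_diag.
by congr (_ *m diag_mx _ *m _); apply/rowP => i; rewrite !mxE -expr2 sqrtCK.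
Qed.

Lemma absmx_psd Z : psdmx (absmx Z).
Proof. exact/sqrtmx_psd/psdmx_gram. Qed.

Lemma sqr_absmx Z : absmx Z *m absmx Z = Z ^t* *m Z.
Proof. exact/sqr_sqrtmx/psdmx_gram. Qed.

End AbsoluteValue.

Local Open Scope complex_scope.

Section UnitarilyInvariantNorm.
Context {R : realType} {n : nat}.
Implicit Types (N : 'M[R[i]]_n -> R) (Y Z : 'M[R[i]]_n).

Record matrix_norm N : Prop := MatrixNorm {
  matrix_norm_ge0 : forall Z, 0 <= N Z;
  matrix_norm_eq0 : forall Z, N Z = 0 -> Z = 0;
  matrix_normZ : forall (a : R[i]) Z,
    N (a *: Z) = ComplexField.Normc.normc a * N Z;
  matrix_normD : forall Y Z, N (Y + Z) <= N Y + N Z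
}.

Definition unitarily_invariant N : Prop :=
  forall Z (U V : 'M[R[i]]_n), U \is unitarymx -> V \is unitarymx ->
    N (U *m Z *m V) = N Z.

Definition unitarily_invariant_norm N : Prop :=
  matrix_norm N /\ unitarily_invariant N.

End UnitarilyInvariantNorm.

(* Main.v *)
Require Import Defs.
From HB Require Import structures.
From mathcomp Require Import all_boot all_order all_fingroup all_algebra.
From mathcomp Require Import complex.
From mathcomp Require Import reals ring lra classical_sets.

Import Order.TTheory GRing.Theory Num.Theory Num.Def.
Local Open Scope ring_scope.
Local Open Scope sesquilinear_scope.

Set Implicit Arguments.
Unset Strict Implicit.
Unset Printing Implicit Defensive.

(** Write [A_k = W_k |A_k|] with [W_k] unitary, put [Q = sum |A_k|] and
    [r = min(m, n)].

    Upper bound.  Let [U T V = diag(s)] be a singular value decomposition of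
    [T = sum A_k].  Each [s_i] is the sum over [k] of the values
    [u |A_k| y^*], where [u] is row [i] of [U W_k] and [y] is row [i] of
    [V^*].  Expanding [0 <= (t u - y) |A_k| (t u - y)^*] for [t > 0] and
    summing over [k] bounds [s_i] by the [i]-th diagonal entry of
      [Y = t/2 sum (U W_k) |A_k| (U W_k)^* + 1/(2t) V^* Q V]
    ([singular_value_le]).  A unitarily invariant norm of a nonnegative
    diagonal matrix is at most the norm of any matrix whose diagonal
    dominates it ([ui_diag_le]): both deleting off-diagonal entries and
    shrinking a diagonal entry are convex combinations of a matrix with its
    images under sign changes.  Hence ([ui_sum_amgm])
      [N T <= t/2 sum N |A_k| + 1/(2t) N Q].
    Finally [sum N |A_k| <= r N Q] ([ui_sum_psd_le]): the factor [m] comes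
    from monotonicity on positive semidefinite matrices, and the factor [n]
    from comparing both sides with the trace, since
    [N P <= tr P * N E <= n * N P] for [P] positive semidefinite and [E] a
    diagonal matrix unit.  The choice [t = 1/sqrt r] gives the constant
    [sqrt r].

    Sharpness.  Take the operator norm and [A_k = e_0 e_k^*] for [k < r],
    the other [A_k] being [0].  Then [Q] is a coordinate projection, of norm
    at most [1], while [T = e_0 (e_0 + ... + e_(r-1))^*] has norm at least
    [sqrt r] ([delta_rowmx_sharp]). *)

Local Notation "A ^!" :=
  (orthomx conjC (mx_of_hermitian (hermitian1mx _)) A) : matrix_set_scope.

Section UnitaryMatrices.

(** * Polar and singular value decompositions *)

Context {C : numClosedFieldType}.

Lemma gram_eq0 p n (M : 'M[C]_(p, n)) : M *m M ^t* = 0 -> M = 0.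
Proof.
move=> M0; apply/matrixP => i j; rewrite [RHS]mxE.
have /matrixP/(_ i i) := M0; rewrite !mxE.
under eq_bigr do rewrite !mxE -normCK.
move=> /psumr_eq0P/(_ j isT) H; apply/eqP; rewrite -normr_eq0 -sqrf_eq0.
by apply/eqP/H => k _; rewrite exprn_ge0.
Qed.

(** The ambient dimension is written [r + q] so that the completed matrix is
    square without a cast. *)
Lemma unitarymx_extend r q (U : 'M[C]_(r, r + q)) : U \is unitarymx ->
  exists V : 'M[C]_(q, r + q), col_mx U V \is unitarymx.
Proof.
move=> Uu; have [V [Vu UV]] : exists V : 'M[C]_(q, r + q),
    V \is unitarymx /\ U *m V ^t* = 0.
  have rq : \rank U^!%MS = q by rewrite rank_ortho mxrank_unitary // addKn.
  have : exists V : 'M[C]_(\rank U^!%MS, r + q),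
    V \is unitarymx /\ U *m V ^t* = 0.
    exists (schmidt (row_base U^!%MS)); split.
      by rewrite schmidt_unitarymx // rank_leq_col.
    apply/orthomx1P; rewrite orthomx_sym.
    by rewrite eqmx_schmidt_free ?row_base_free // eq_row_base.
  by rewrite rq.
exists V.
have VU : V *m U ^t* = 0.
  by rewrite -[LHS]trmxCK trmx_mul map_mxM trmxCK UV trmx0 map_mx0.
apply/unitarymxP; rewrite tr_col_mx map_row_mx mul_col_row.
by rewrite (unitarymxP Uu) (unitarymxP Vu) UV VU -scalar_mx_block.
Qed.

(** Equal Gram matrices mean that [B] and [A] have corresponding rows with
    the same inner products, so the map sending rows of [B] to rows of [A] is
    an isometry between the row spaces; it is extended by any isometry of the
    orthogonal complements. *)
Lemma gram_eq_unitary p n (A B : 'M[C]_(p, n)) : A *m A ^t* = B *m B ^t* ->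
  exists2 W : 'M[C]_n, W \is unitarymx & A = B *m W.
Proof.
move=> AB.
(* [K] holds the coefficients producing an orthonormal basis [K *m B] of the
   row space of [B]; the same coefficients applied to [A] work for [A]. *)
pose K := schmidt (row_base B) *m pinvmx B.
have KB : K *m B = schmidt (row_base B).
  by rewrite mulmxKpV // eqmx_schmidt_free ?row_base_free // eq_row_base.
have KBu : K *m B \is unitarymx by rewrite KB schmidt_unitarymx // rank_leq_col.
have BKB : B *m (K *m B) ^t* *m (K *m B) = B.
  have /submxP[D BD] : (B <= K *m B)%MS.
    by rewrite KB eqmx_schmidt_free ?row_base_free // eq_row_base.
  by rewrite [X in X *m _ *m _]BD mulmxtVK.
(* Only the rank matters from here on; the dimension is split as [r + q]. *)
have := rank_leq_col B.
move: (\rank B) K {KB} KBu BKB => r K KBu BKB /subnKC.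
move: (n - r)%N => q E; case: _ / E A B AB KBu BKB => A B AB KBu BKB.
have KAu : K *m A \is unitarymx.
  apply/unitarymxP; rewrite -(unitarymxP KBu).
  by rewrite !trmx_mul !map_mxM !mulmxA -(mulmxA K A) -(mulmxA K B) AB.
have AKA : A *m (K *m A) ^t* *m (K *m A) = A.
  apply/eqP; rewrite -subr_eq0; apply/eqP/gram_eq0.
  (* The Gram matrix of the defect depends on [X] only through [G]. *)
  have gramE (X : 'M[C]_(p, r + q)) (G := X *m X ^t*) :
      (X *m (K *m X) ^t* *m (K *m X) - X)
        *m (X *m (K *m X) ^t* *m (K *m X) - X) ^t*
      = (G *m K ^t* *m K - 1%:M) *m G *m (G *m K ^t* *m K - 1%:M) ^t*.
    have -> : X *m (K *m X) ^t* *m (K *m X) - X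
              = (G *m K ^t* *m K - 1%:M) *m X.
      by rewrite mulmxBl mul1mx trmx_mul map_mxM !mulmxA.
    by rewrite trmx_mul map_mxM !mulmxA -(mulmxA _ X).
  by rewrite gramE AB -gramE BKB subrr mul0mx.
have [VA VAu] := unitarymx_extend KAu.
have [VB VBu] := unitarymx_extend KBu.
exists ((col_mx (K *m B) VB) ^t* *m col_mx (K *m A) VA).
  by rewrite mul_unitarymx // trmxC_unitary.
have BV : B *m VB ^t* = 0.
  have /unitarymxP := VBu; rewrite tr_col_mx map_row_mx mul_col_row.
  rewrite scalar_mx_block => /eq_block_mx[_ UV _ _].
  by rewrite -BKB -mulmxA UV mulmx0.
rewrite tr_col_mx map_row_mx mulmxA mul_mx_row BV mul_row_col mul0mx addr0.
have -> : B *m (K *m B) ^t* = A *m (K *m A) ^t*.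
  by rewrite !trmx_mul !map_mxM !mulmxA AB.
by rewrite AKA.
Qed.

Context {n : nat}.
Implicit Types (A P : 'M[C]_n).

(** [A^*] and [|A|] have the same Gram matrix [A^* A = |A|^2]. *)
Lemma polar_decomposition A :
  exists2 W : 'M[C]_n, W \is unitarymx & A = W *m absmx A.
Proof.
have [hP _] := absmx_psd A.
have [W Wu AW] : exists2 W : 'M[C]_n, W \is unitarymx
    & A ^t* = (absmx A) ^t* *m W.
  apply: gram_eq_unitary; rewrite !trmxCK -sqr_absmx.
  by move: hP; rewrite hermsymmxE => /eqP <-.
exists (W ^t*); first by rewrite trmxC_unitary.
by rewrite -[LHS]trmxCK AW trmx_mul map_mxM trmxCK.
Qed.

Lemma psd_diagonalize P : psdmx P ->
  exists U : 'M[C]_n, exists x : 'rV[C]_n,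
  [/\ U \is unitarymx, forall i, 0 <= x 0 i & U *m P *m U ^t* = diag_mx x].
Proof.
move=> pP; exists (spectralmx P), (spectral_diag P).
have Uu := spectral_unitarymx P; split=> // [i|].
  exact: psd_spectral_diag_ge0.
rewrite {2}(psd_spectralE pP) !mulmxA (unitarymxP Uu) mul1mx.
by rewrite -mulmxA (unitarymxP Uu) mulmx1.
Qed.

Lemma singular_value_decomposition A :
  exists U V : 'M[C]_n, exists s : 'rV[C]_n,
  [/\ U \is unitarymx, V \is unitarymx, forall i, 0 <= s 0 i
    & U *m A *m V = diag_mx s].
Proof.
have [W Wu AW] := polar_decomposition A.
have [U [s [Uu s0 Us]]] := psd_diagonalize (absmx_psd A).
exists (U *m W ^t*), (U ^t*), s; split=> //.
- by rewrite mul_unitarymx // trmxC_unitary.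
- by rewrite trmxC_unitary.
rewrite {1}AW; move: (absmx A) Us => P Us.
have WW : W ^t* *m W = 1%:M by apply/mulmx1C/unitarymxP.
by rewrite !mulmxA -(mulmxA U) WW mulmx1.
Qed.

(** The eigenvalues of an idempotent are [0] and [1], fixed by [sqrtC]. *)
Lemma sqrtmx_idempotent P : psdmx P -> P *m P = P -> sqrtmx P = P.
Proof.
move=> pP PP; have /unitarymxP Uu := spectral_unitarymx P.
rewrite [RHS](psd_spectralE pP) /sqrtmx invmx_unitary ?spectral_unitarymx //.
suff -> : map_mx sqrtC (spectral_diag P) = spectral_diag P by [].
apply/rowP => i; rewrite mxE.
set U := spectralmx P in Uu *; set d := spectral_diag P.
have /matrixP/(_ i i) : diag_mx d *m diag_mx d = diag_mx d.
  have dE : diag_mx d = U *m P *m U ^t*.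
    by rewrite (psd_spectralE pP) !mulmxA Uu mul1mx -mulmxA Uu mulmx1.
  rewrite dE !mulmxA -(mulmxA _ (U ^t*)) -[in RHS]PP.
  have -> : U ^t* *m U = 1%:M by apply: mulmx1C.
  by rewrite mulmx1 !mulmxA.
rewrite mulmx_diag !mxE eqxx !mulr1n => /eqP.
rewrite -subr_eq0 -[X in _ - X]mulr1 -mulrBr mulf_eq0 subr_eq0.
by case/orP => /eqP ->; rewrite ?sqrtC0 ?sqrtC1.
Qed.

Lemma unitarymx1 : 1%:M \is @unitarymx C n n.
Proof.
by apply/unitarymxP; rewrite trmx1 map_mx1 mulmx1.
Qed.

Definition signmx (i : 'I_n) : 'M[C]_n :=
  diag_mx (\row_j (if j == i then -1 else 1)).

Lemma unitarymx_adj (U : 'M[C]_n) : U \is unitarymx -> U ^t* \is unitarymx.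
Proof. by rewrite trmxC_unitary. Qed.

Lemma signmx_unitary i : signmx i \is unitarymx.
Proof.
apply/unitarymxP; rewrite tr_diag_mx map_diag_mx mulmx_diag -diag_const_mx.
congr diag_mx; apply/rowP => j; rewrite !mxE.
by case: eqP => _; rewrite ?rmorphN rmorph1 ?mulrNN mulr1.
Qed.

Lemma tperm_mx_unitary (i j : 'I_n) : tperm_mx i j \is @unitarymx C n n.
Proof.
apply/unitarymxP.
by rewrite tr_perm_mx map_perm_mx -perm_mxM mulgV perm_mx1.
Qed.

(** * Quadratic forms and the bound on singular values *)

Definition qform P (v : 'rV[C]_n) : C := (v *m P *m v ^t*) 0 0.

Lemma qform_row (U P : 'M[C]_n) i :
  (U *m P *m U ^t*) i i = qform P (row i U).
Proof.
rewrite /qform -row_mul !mxE; apply: eq_bigr => k _.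
by rewrite !mxE.
Qed.

Lemma qform_delta P i : qform P (delta_mx 0 i) = P i i.
Proof.
by rewrite /qform -rowE trmx_delta map_delta_mx -colE !mxE.
Qed.

Lemma qform_sum m (B : 'I_m -> 'M[C]_n) v :
  qform (\sum_k B k) v = \sum_k qform (B k) v.
Proof. by rewrite /qform mulmx_sumr mulmx_suml summxE. Qed.

Lemma psdmx_sum m (B : 'I_m -> 'M[C]_n) :
  (forall k, psdmx (B k)) -> psdmx (\sum_k B k).
Proof.
move=> pB; split=> [|v].
  rewrite hermsymmxE; apply/eqP/matrixP => i j.
  rewrite !mxE !summxE rmorph_sum; apply: eq_bigr => k _.
  by have [] := pB k; rewrite hermsymmxE => /eqP hB _; rewrite {1}hB !mxE.
rewrite -[_ 0 0]/(qform _ v) qform_sum sumr_ge0 // => k _.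
exact: (proj2 (pB k)).
Qed.

(** Expand [0 <= qform P (t *: u - v)]. *)
Lemma psd_amgm (t : C) P (u v : 'rV[C]_n) : 0 <= t -> psdmx P ->
  t * ((u *m P *m v ^t*) 0 0 + conjC ((u *m P *m v ^t*) 0 0))
    <= t ^+ 2 * qform P u + qform P v.
Proof.
move=> t0 [/eqP hP pP]; rewrite expr0 scale1r in hP.
have -> : conjC ((u *m P *m v ^t*) 0 0) = (v *m P *m u ^t*) 0 0.
  transitivity (((u *m P *m v ^t*) ^t*) 0 0); first by rewrite !mxE.
  by rewrite !trmx_mul !map_mxM trmxCK mulmxA {2}hP.
rewrite -subr_ge0; apply: le_trans (pP (t *: u - v)) _.
have -> : (t *: u - v) ^t* = t *: u ^t* - v ^t*.
  apply/matrixP => i j; rewrite !mxE rmorphB rmorphM.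
  by congr (_ * _ - _); apply: geC0_conj.
have subE (X Y : 'M[C]_1) : (X - Y) 0 0 = X 0 0 - Y 0 0 by rewrite !mxE.
have scaleE c (X : 'M[C]_1) : (c *: X) 0 0 = c * X 0 0 by rewrite mxE.
rewrite !(mulmxBl, mulmxBr) -!scalemxAl -!scalemxAr /qform !subE !scaleE.
move: ((u *m P *m u ^t*) 0 0) ((v *m P *m u ^t*) 0 0) => a b.
move: ((u *m P *m v ^t*) 0 0) ((v *m P *m v ^t*) 0 0) => c d.
by rewrite le_eqVlt; apply/orP; left; apply/eqP; ring.
Qed.

(** Row [i] of [U W_k] and row [i] of [V^*] are the two vectors paired by
    [B k] in [s_i]; as [s_i] is real, it equals half the sum of these pairings
    and their conjugates, to which [psd_amgm] applies. *)
Lemma singular_value_le m (t : C) (W B : 'I_m -> 'M[C]_n) (U V : 'M[C]_n)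
    (s : 'rV[C]_n) i : 0 < t -> (forall k, psdmx (B k)) -> 0 <= s 0 i ->
  U *m (\sum_k W k *m B k) *m V = diag_mx s ->
  s 0 i <= ((2^-1 * t) *: (\sum_k (U *m W k) *m B k *m (U *m W k) ^t*)
            + (2^-1 * t^-1) *: (V ^t* *m (\sum_k B k) *m V ^t* ^t*)) i i.
Proof.
move=> t0 pB s0 UTV.
have h0 : 0 <= 2^-1 * t^-1 by rewrite mulr_ge0 // invr_ge0 ?ler0n ?(ltW t0).
set P := \sum_k (_ *m _ *m _); set Q := V ^t* *m _ *m _.
have -> : ((2^-1 * t) *: P + (2^-1 * t^-1) *: Q) i i =
   (2^-1 * t^-1) * (t ^+ 2 * P i i + Q i i).
  by move: P Q => P Q; rewrite !mxE; field; rewrite gt_eqF.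
pose b k := (row i (U *m W k) *m B k *m (row i (V ^t*)) ^t*) 0 0.
have sb : s 0 i = \sum_k b k.
  have -> : s 0 i = diag_mx s i i by rewrite mxE eqxx mulr1n.
  rewrite -UTV mulmx_sumr mulmx_suml summxE; apply: eq_bigr => k _.
  rewrite /b mulmxA -row_mul !mxE.
  by apply: eq_bigr => j _; rewrite !mxE conjCK.
have -> : s 0 i = (2^-1 * t^-1) * \sum_k t * (b k + conjC (b k)).
  rewrite -mulr_sumr big_split /= -rmorph_sum -sb.
  by rewrite [X in _ * (_ * (_ + X))](geC0_conj s0); field; rewrite gt_eqF.
apply: ler_wpM2l => //.
rewrite /P /Q qform_row qform_sum summxE mulr_sumr.
rewrite -big_split /=; apply: ler_sum => k _.
by rewrite qform_row; apply: psd_amgm => //; apply: ltW.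
Qed.

End UnitaryMatrices.

Local Open Scope complex_scope.

(** * Unitarily invariant norms and diagonals *)

Section Norm.
Context {R : realType} {n : nat}.
Context (N : 'M[R[i]]_n -> R) (uiN : unitarily_invariant_norm N).
Implicit Types (X Y P : 'M[R[i]]_n) (x y : 'rV[R]_n).

Definition diagR x : 'M[R[i]]_n := diag_mx (map_mx (real_complex R) x).

Lemma uiD X Y : N (X + Y) <= N X + N Y.
Proof. by case: uiN => -[]. Qed.

Lemma uiU X U V : U \is unitarymx -> V \is unitarymx -> N (U *m X *m V) = N X.
Proof. exact: (proj2 uiN). Qed.

Lemma uiZ (t : R) X : 0 <= t -> N (t%:C *: X) = t * N X.
Proof.
move=> t0; case: uiN => -[_ _ -> _] _; congr (_ * _).
by rewrite /= expr0n /= addr0 sqrtr_sqr ger0_norm.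
Qed.

Lemma ui0 : N 0 = 0.
Proof. by rewrite -(scale0r (0 : 'M[R[i]]_n)) -[0 : R[i]]/(0%:C) uiZ // mul0r. Qed.

Lemma ui_sum I (r : seq I) (F : I -> 'M[R[i]]_n) :
  N (\sum_(i <- r) F i) <= \sum_(i <- r) N (F i).
Proof.
elim/big_rec2: _ => [|i a b _ ab]; first by rewrite ui0.
by rewrite (le_trans (uiD _ _)) // lerD2l.
Qed.

(** With sign changes for [U] and [V], such combinations delete off-diagonal
    entries or shrink diagonal ones. *)
Lemma ui_convex (t : R) X U V : 0 <= t <= 1 ->
  U \is unitarymx -> V \is unitarymx ->
  N ((1 - t)%:C *: X + t%:C *: (U *m X *m V)) <= N X.
Proof.
move=> /andP[t0 t1] Uu Vu; rewrite (le_trans (uiD _ _)) //.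
by rewrite !uiZ ?subr_ge0 // uiU // -mulrDl subrK mul1r.
Qed.

Lemma signmx_conjE i X j k : (signmx i *m X *m signmx i) j k =
  (if (j == i) (+) (k == i) then - X j k else X j k).
Proof.
rewrite mul_mx_diag mxE mul_diag_mx !mxE.
by do 2!case: eqP => _ /=; rewrite ?(mulN1r, mul1r, mulrN1, mulr1, opprK).
Qed.

(** Averaging a matrix with its conjugate by a sign change of coordinate [i]
    deletes row and column [i] off the diagonal; do this for all [i]. *)
Lemma ui_pinch Y : N (diag_mx (\row_i Y i i)) <= N Y.
Proof.
(* Off-diagonal entries are deleted in rows and columns listed in [s]. *)
pose Z (s : seq 'I_n) : 'M[R[i]]_n := \matrix_(j, k)
  if (j == k) || (j \notin s) && (k \notin s) then Y j k else 0.
suff ZY s : N (Z s) <= N Y.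
  suff -> : diag_mx (\row_i Y i i) = Z (enum 'I_n) by [].
  apply/matrixP => j k; rewrite !mxE !mem_enum orbF.
  by case: eqP => [->|]; rewrite ?mulr1n ?mulr0n.
elim: s => [|i s IHs].
  suff -> : Z [::] = Y by [].
  by apply/matrixP => j k; rewrite mxE orbT.
apply: le_trans IHs.
have t01 : 0 <= (2^-1 : R) <= 1 by lra.
have /le_trans := ui_convex (Z s) t01 (signmx_unitary i) (signmx_unitary i).
suff -> : Z (i :: s) = (1 - 2^-1)%:C *: Z s
                       + (2^-1)%:C *: (signmx i *m Z s *m signmx i) by apply.
apply/matrixP => j k; rewrite [RHS]mxE [X in _ = X + _]mxE [X in _ = _ + X]mxE.
rewrite signmx_conjE.
have half : (1 - 2^-1)%:C = (2^-1)%:C :> R[i].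
  by congr (_%:C); lra.
have halfD (z : R[i]) : (2^-1)%:C * z + (2^-1)%:C * z = z.
  have h1 : 2^-1 + 2^-1 = 1 :> R by lra.
  by rewrite -mulrDl -rmorphD h1 mul1r.
rewrite half !mxE !inE; have [->|jk] /= := eqVneq j k.
  by rewrite addbb halfD.
case: (eqVneq j i) => [ji|_]; case: (eqVneq k i) => [ki|_] //=.
- by rewrite ji ki eqxx in jk.
- by rewrite mulrN subrr.
- by rewrite andbF mulrN subrr.
Qed.

(** When [`|x_i| <= y_i], the number [x_i] is a convex combination of [y_i]
    and [- y_i]; replace the coordinates one at a time. *)
Lemma ui_diag_mono x y : (forall i, `|x 0 i| <= y 0 i) ->
  N (diagR x) <= N (diagR y).
Proof.
move=> xy; pose z (s : seq 'I_n) := \row_i (if i \in s then x 0 i else y 0 i).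
suff zy s : N (diagR (z s)) <= N (diagR y).
  suff -> : x = z (enum 'I_n) by [].
  by apply/rowP => i; rewrite mxE mem_enum.
elim: s => [|i s IHs].
  suff -> : z [::] = y by [].
  by apply/rowP => j; rewrite mxE.
apply: le_trans IHs; have [is_|is_] := boolP (i \in s).
  suff -> : z (i :: s) = z s by [].
  by apply/rowP => j; rewrite !mxE inE; case: eqP => [->|]; rewrite ?is_.
(* Solves [(1 - t) y_i - t y_i = x_i]; it is [0] when [y_i = 0]. *)
pose t := (y 0 i - x 0 i) / (2 * y 0 i).
have y0 : 0 <= y 0 i by rewrite (le_trans _ (xy i)).
have tE : y 0 i - t * y 0 i - t * y 0 i = x 0 i.
  have [yi0|yi0] := eqVneq (y 0 i) 0.
    by have := xy i; rewrite yi0 normr_le0 => /eqP ->; rewrite !mulr0 !subr0.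
  by rewrite /t; field.
have t01 : 0 <= t <= 1.
  have /andP[? ?] : - y 0 i <= x 0 i <= y 0 i by rewrite -ler_norml.
  rewrite /t divr_ge0 ?subr_ge0 ?mulr_ge0 //=.
  have [->|yi0] := eqVneq (y 0 i) 0; first by rewrite mulr0 invr0 mulr0.
  by rewrite ler_pdivrMr ?mulr_gt0 ?lt0r ?yi0 //; lra.
have /le_trans := ui_convex (diagR (z s)) t01 (signmx_unitary i) unitarymx1.
suff -> : diagR (z (i :: s)) = (1 - t)%:C *: diagR (z s)
            + t%:C *: (signmx i *m diagR (z s) *m 1%:M) by apply.
rewrite mulmx1 /signmx mulmx_diag -!linearZ -linearD; congr diag_mx.
apply/rowP => j; rewrite !mxE inE.
have [->|_] /= := eqVneq j i.
  rewrite (negPf is_) mulN1r -rmorphN -!rmorphM -rmorphD -[in LHS]tE.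
  by congr _%:C; ring.
by rewrite mul1r -!rmorphM -rmorphD; congr _%:C; ring.
Qed.

(** Pass from [Y] to its diagonal by [ui_pinch], then shrink the entries. *)
Lemma ui_diag_le x Y : (forall i, 0 <= x 0 i) ->
  (forall i, (x 0 i)%:C <= Y i i) -> N (diagR x) <= N Y.
Proof.
move=> x0 xY; apply: le_trans (ui_pinch Y).
suff -> : \row_i Y i i = map_mx (real_complex R) (\row_i complex.Re (Y i i)).
  apply: ui_diag_mono => i; rewrite mxE ger0_norm //.
  by have := xY i; rewrite lecE => /andP[].
apply/rowP => i; rewrite !mxE RRe_real //.
by rewrite ger0_real // (le_trans _ (xY i)) // ler0c.
Qed.

Lemma diag_ge0R (z : 'rV[R[i]]_n) : (forall i, 0 <= z 0 i) ->
  exists2 x : 'rV[R]_n, forall i, 0 <= x 0 i & diag_mx z = diagR x.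
Proof.
move=> z0; exists (map_mx (@complex.Re R) z).
  by move=> i; have := z0 i; rewrite mxE lecE => /andP[].
by congr diag_mx; apply/rowP => i; rewrite !mxE RRe_real // ger0_real.
Qed.

Lemma psd_diagonalizeR P : psdmx P ->
  exists U x, [/\ U \is unitarymx, forall i, 0 <= x 0 i
    & U *m P *m U ^t* = diagR x].
Proof.
move=> /psd_diagonalize[U [z [Uu /diag_ge0R[x x0 zx] Uz]]].
by exists U, x; rewrite Uz zx.
Qed.

(** In an orthonormal basis diagonalizing [X], the diagonal of [Y] dominates
    the eigenvalues of [X]. *)
Lemma ui_psd_mono X Y : psdmx X -> (forall v, qform X v <= qform Y v) ->
  N X <= N Y.
Proof.
move=> /psd_diagonalizeR[U [x [Uu x0 Ux]]] XY.
have Uu' := unitarymx_adj Uu.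
rewrite -(uiU X Uu Uu') -(uiU Y Uu Uu') Ux; apply: ui_diag_le => // i.
have -> : (x 0 i)%:C = diagR x i i by rewrite !mxE eqxx mulr1n.
by rewrite -Ux !qform_row.
Qed.

(** * Comparing sums of norms with the norm of a sum *)

Lemma ui_delta (i j : 'I_n) : N (delta_mx i i) = N (delta_mx j j).
Proof.
have Pu C := @tperm_mx_unitary C n i j.
rewrite -(uiU (delta_mx i i) (Pu _) (Pu _)); congr N.
apply/matrixP => k l; rewrite -xrowE -xcolE !mxE.
have tE h : (tperm i j h == i) = (h == j).
  by rewrite -[X in _ == X](tpermR i j) (can_eq (tpermK i j)).
by rewrite !tE.
Qed.

Lemma diagR_sum x : diagR x = \sum_i (x 0 i)%:C *: delta_mx i i.
Proof.
apply/matrixP => j k; rewrite summxE (bigD1 j) //= big1 => [|i ij].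
  rewrite !mxE eqxx addr0 eq_sym.
  by case: eqP => _; rewrite ?mulr1n ?mulr0n ?mulr1 ?mulr0.
by rewrite !mxE eq_sym (negPf ij) mulr0.
Qed.

(** Triangle inequality for the spectral decomposition of [P]. *)
Lemma ui_psd_le_trace P i0 : psdmx P ->
  N P <= complex.Re (\tr P) * N (delta_mx i0 i0).
Proof.
move=> /psd_diagonalizeR[U [x [Uu x0 Ux]]].
have Uu' := unitarymx_adj Uu.
have -> : \tr P = (\sum_i x 0 i)%:C.
  rewrite -[P]mul1mx -(mulmx1C (unitarymxP Uu)) -mulmxA mxtrace_mulC Ux.
  by rewrite mxtrace_diag rmorph_sum; apply: eq_bigr => i _; rewrite mxE.
rewrite -(uiU P Uu Uu') Ux diagR_sum (le_trans (ui_sum _ _)) //=.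
rewrite mulr_suml; apply: ler_sum => i _.
by rewrite uiZ // (ui_delta i i0).
Qed.

(** Each diagonal entry of [P], alone on the diagonal, is dominated by [P]. *)
Lemma ui_trace_le P i0 : psdmx P ->
  complex.Re (\tr P) * N (delta_mx i0 i0) <= n%:R * N P.
Proof.
move=> [_ pP].
have P0 i : 0 <= P i i by rewrite -qform_delta; apply: pP.
rewrite raddf_sum mulr_suml mulr_natl -[n in _ *+ n]card_ord -sumr_const.
apply: ler_sum => i _; rewrite (ui_delta i0 i).
pose x : 'rV[R]_n := \row_j (complex.Re (P i i) *+ (j == i)).
have Re0 : 0 <= complex.Re (P i i) by have := P0 i; rewrite lecE => /andP[].
have -> : complex.Re (P i i) * N (delta_mx i i) = N (diagR x).
  rewrite -uiZ //; congr N; apply/matrixP => j k; rewrite !mxE.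
  case: (eqVneq j k) => [<-|jk]; case: (eqVneq j i) => [ji|_] /=;
    rewrite ?mulr1n ?mulr0n ?mulr1 ?mulr0 //.
  by rewrite -ji eq_sym (negPf jk) mulr0.
apply: ui_diag_le => j; rewrite mxE ?mulrn_wge0 //.
case: eqP => [->|_] //; rewrite mulr1n RRe_real //.
by rewrite ger0_real.
Qed.

(** A Cauchy-Schwarz inequality in additive form; optimizing over [t] would
    give the multiplicative one. *)
Lemma ui_sum_amgm m (t : R) (W B : 'I_m -> 'M[R[i]]_n) : 0 < t ->
  (forall k, W k \is unitarymx) -> (forall k, psdmx (B k)) ->
  N (\sum_k W k *m B k) <= 2^-1 * t * (\sum_k N (B k))
                           + 2^-1 * t^-1 * N (\sum_k B k).
Proof.
move=> t0 Wu pB.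
have [U [V [z [Uu Vu /diag_ge0R[s s0 sz] UTV]]]] :=
  singular_value_decomposition (\sum_k W k *m B k).
rewrite sz in UTV; rewrite -(uiU _ Uu Vu) UTV.
pose P := \sum_k (U *m W k) *m B k *m (U *m W k) ^t*.
pose Q := V ^t* *m (\sum_k B k) *m V ^t* ^t*.
have UWu k := mul_unitarymx Uu (Wu k).
have : N (diagR s) <= N ((2^-1 * t)%:C *: P + (2^-1 * t^-1)%:C *: Q).
  apply: ui_diag_le => // i.
  have := @singular_value_le _ _ m (t%:C) W B U V (map_mx (real_complex R) s) i.
  rewrite !rmorphM !fmorphV !rmorph_nat mxE => H.
  by apply: H => //; rewrite ?ltcR ?ler0c.
move=> /le_trans; apply.
rewrite (le_trans (uiD _ _)) // !uiZ ?mulr_ge0 ?invr_ge0 ?ler0n ?(ltW t0) //.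
rewrite (uiU _ (unitarymx_adj Vu) (unitarymx_adj (unitarymx_adj Vu))) lerD2r.
apply: ler_wpM2l; first by rewrite mulr_ge0 ?(ltW t0) // invr_ge0.
apply: le_trans (ui_sum _ _) _; apply: ler_sum => k _.
by rewrite (uiU _ (UWu k) (unitarymx_adj (UWu k))).
Qed.

(** For the factor [m], each [B k] is below the sum; for the factor [n], the
    traces add up. *)
Lemma ui_sum_psd_le m (B : 'I_m -> 'M[R[i]]_n) : (0 < n)%N ->
  (forall k, psdmx (B k)) ->
  \sum_k N (B k) <= (minn m n)%:R * N (\sum_k B k).
Proof.
move=> n0 pB; case: (leqP m n) => mn.
  rewrite mulr_natl -[m in _ *+ m]card_ord -sumr_const; apply: ler_sum => k _.
  apply: ui_psd_mono => // v; rewrite qform_sum (bigD1 k) //= lerDl.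
  by apply: sumr_ge0 => j _; exact: (proj2 (pB j)).
pose i0 := Ordinal n0.
apply: le_trans (ui_trace_le i0 (psdmx_sum pB)).
have -> : \tr (\sum_k B k) = \sum_k \tr (B k) by exact: raddf_sum.
have -> : complex.Re (\sum_k \tr (B k)) = \sum_k complex.Re (\tr (B k)).
  exact: raddf_sum.
rewrite mulr_suml.
by apply: ler_sum => k _; apply/ui_psd_le_trace.
Qed.

(** [ui_sum_amgm] with [t] the inverse of the square root. *)
Lemma ui_sum_polar_le m (W B : 'I_m -> 'M[R[i]]_n) : (0 < m)%N -> (0 < n)%N ->
  (forall k, W k \is unitarymx) -> (forall k, psdmx (B k)) ->
  N (\sum_k W k *m B k) <= Num.sqrt (minn m n)%:R * N (\sum_k B k).
Proof.
move=> m0 n0 Wu pB; set q : R := Num.sqrt _.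
have q0 : 0 < q by rewrite sqrtr_gt0 ltr0n leq_min m0.
have q2 : (minn m n)%:R = q ^+ 2 :> R by rewrite sqr_sqrtr.
have qV : 0 < q^-1 by rewrite invr_gt0.
apply: le_trans (ui_sum_amgm qV Wu pB) _.
have := ui_sum_psd_le n0 pB; rewrite q2.
move: (\sum_k N (B k)) (N (\sum_k B k)) => a b.
have hq : 0 <= 2^-1 * q^-1 by rewrite mulr_ge0 ?(ltW qV) // invr_ge0.
move=> /(ler_wpM2l hq) ab; apply: le_trans (lerD ab (lexx _)) _.
by rewrite invrK le_eqVlt; apply/orP; left; apply/eqP; field; rewrite gt_eqF.
Qed.

Lemma ui_sum_le m (A : 'I_m -> 'M[R[i]]_n) : (0 < m)%N -> (0 < n)%N ->
  N (\sum_(k < m) A k)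
    <= Num.sqrt (minn m n)%:R * N (\sum_(k < m) absmx (A k)).
Proof.
move=> m0 n0.
have [W WA] : exists W : 'I_m -> 'M[R[i]]_n,
    forall k, W k \is unitarymx /\ A k = W k *m absmx (A k).
  apply: (@fin_all_exists _ _
    (fun k V => V \is unitarymx /\ A k = V *m absmx (A k))).
  by move=> k; have [V] := polar_decomposition (A k); exists V.
rewrite (eq_bigr _ (fun k _ => proj2 (WA k))).
apply: ui_sum_polar_le => // k; first exact: (proj1 (WA k)).
exact: absmx_psd.
Qed.

End Norm.

(** * The extremal family *)

Section Extremal.
Context {C : numClosedFieldType} {n : nat}.
Implicit Types (x y : 'rV[C]_n) (Z : 'M[C]_n).

(** For a single row, being unitary means being a unit vector. *)
Lemma unit_row_normE x : (x \is unitarymx) = (\sum_i `|x 0 i| ^+ 2 == 1).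
Proof.
have xx : (x *m x ^t*) 0 0 = \sum_i `|x 0 i| ^+ 2.
  by rewrite mxE; apply: eq_bigr => i _; rewrite !mxE normCK.
rewrite -xx; apply/unitarymxP/eqP => [->|x1]; first by rewrite mxE.
by rewrite [LHS]mx11_scalar x1.
Qed.

Lemma unit_row_coord_le1 x i : x \is unitarymx -> `|x 0 i| <= 1.
Proof.
rewrite unit_row_normE => /eqP x1; rewrite -(expr_le1 (n := 2)) // -x1.
by rewrite (bigD1 i) //= lerDl sumr_ge0 // => j _; rewrite exprn_ge0.
Qed.

Lemma delta_unit_row i : delta_mx 0 i \is @unitarymx C 1 n.
Proof.
rewrite unit_row_normE (bigD1 i) //= big1 ?mxE ?eqxx ?normr1 ?expr1n ?addr0 //.
by move=> j ji; rewrite mxE (negPf ji) normr0 expr0n.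
Qed.

Lemma bilinear_le_sum_entries x y Z :
  x \is unitarymx -> y \is unitarymx ->
  `|(x *m Z *m y ^t*) 0 0| <= \sum_j \sum_i `|Z i j|.
Proof.
move=> x1 y1; rewrite mxE (le_trans (ler_norm_sum _ _ _)) //.
apply: ler_sum => j _; rewrite !mxE normrM norm_conjC.
apply: le_trans (ler_piMr (normr_ge0 _) (unit_row_coord_le1 _ y1)) _.
rewrite (le_trans (ler_norm_sum _ _ _)) //; apply: ler_sum => i _.
by rewrite normrM ler_piMl // unit_row_coord_le1.
Qed.

Context (i0 : 'I_n).

(** The index [k] is a natural number so that the family may have more
    members than there are columns: the matrix is [0] for [n <= k]. *)
Definition delta_rowmx (k : nat) : 'M[C]_n :=
  \matrix_(i, j) ((i == i0) && (j == k :> nat))%:R.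

(** The Gram matrix is a projection, hence its own square root. *)
Lemma absmx_delta_rowmx k :
  absmx (delta_rowmx k) = \matrix_(i, j) ((i == k :> nat) && (j == k :> nat))%:R.
Proof.
have gramE : delta_rowmx k ^t* *m delta_rowmx k
    = \matrix_(i, j) ((i == k :> nat) && (j == k :> nat))%:R.
  apply/matrixP => i j; rewrite !mxE (bigD1 i0) //= big1 => [|l li0].
    by rewrite !mxE !eqxx /= rmorph_nat -natrM mulnb addr0.
  by rewrite !mxE (negPf li0) mulr0.
rewrite /absmx sqrtmx_idempotent //; first exact: psdmx_gram.
rewrite !gramE; apply/matrixP => i j; rewrite !mxE.
have [kn|nk] := ltnP k n.
  rewrite (bigD1 (Ordinal kn)) //= big1 => [|l /negPf lk].
    by rewrite !mxE eqxx andbT /= addr0 -natrM mulnb.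
  have {}lk : (l == k :> nat) = false by exact: lk.
  by rewrite !mxE lk andbF mul0r.
have ik (l : 'I_n) : (l == k :> nat) = false by rewrite ltn_eqF // (leq_trans _ nk).
by rewrite ik big1 // => l _; rewrite !mxE !ik mul0r.
Qed.

Context (m : nat).

Lemma sum_nat_eq_ord (b : bool) (j : nat) :
  \sum_(k < m) (b && (j == k :> nat))%:R = (b && (j < m)%N)%:R :> C.
Proof.
have [jm|mj] := ltnP j m; last first.
  rewrite andbF big1 // => k _; rewrite gtn_eqF ?andbF //.
  exact: leq_trans mj.
rewrite (bigD1 (Ordinal jm)) //= eqxx big1 ?addr0 // => k /negPf kj.
have {}kj : (k == j :> nat) = false by exact: kj.
by rewrite eq_sym kj andbF.
Qed.

Lemma bilinear_sum_absmx_delta_rowmx_le1 x y :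
  x \is unitarymx -> y \is unitarymx ->
  `|(x *m (\sum_(k < m) absmx (delta_rowmx k)) *m y ^t*) 0 0| <= 1.
Proof.
rewrite !unit_row_normE => /eqP x1 /eqP y1.
have -> : \sum_(k < m) absmx (delta_rowmx k)
          = diag_mx (\row_(j < n) (j < m)%N%:R) :> 'M[C]_n.
  apply/matrixP => i j; rewrite summxE !mxE.
  under eq_bigr => k _ do rewrite absmx_delta_rowmx mxE.
  have [->|/negPf ij] := eqVneq i j.
    under eq_bigr do rewrite andbb -[_ == _]andTb.
    by rewrite sum_nat_eq_ord mulr1n.
  rewrite big1 // => k _; have [ik|//] := eqVneq (i : nat) k.
  have {}ij : (i == j :> nat) = false by exact: ij.
  by rewrite -ik eq_sym ij.
rewrite mul_mx_diag mxE (le_trans (ler_norm_sum _ _ _)) //.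
have amgm (a b : C) : 0 <= a -> 0 <= b -> a * b <= 2^-1 * a ^+ 2 + 2^-1 * b ^+ 2.
  move=> a0 b0; rewrite -subr_ge0.
  have -> : 2^-1 * a ^+ 2 + 2^-1 * b ^+ 2 - a * b = 2^-1 * (a - b) ^+ 2 by field.
  by rewrite mulr_ge0 ?invr_ge0 ?ler0n // real_exprn_even_ge0 // rpredB ?ger0_real.
apply: (@le_trans _ _ (\sum_j (2^-1 * `|x 0 j| ^+ 2 + 2^-1 * `|y 0 j| ^+ 2))).
  apply: ler_sum => j _; rewrite !mxE !normrM norm_conjC.
  apply: le_trans (amgm _ _ (normr_ge0 _) (normr_ge0 _)).
  by rewrite ler_wpM2r // ler_piMr // normr_nat; case: (_ < _)%N; rewrite ?ler01.
rewrite big_split /= -!mulr_sumr x1 y1 !mulr1.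
by have -> : 2^-1 + 2^-1 = 1 :> C by field.
Qed.

Lemma sum_ltn_ord : \sum_(j < n) (j < m)%N%:R = (minn m n)%:R :> C.
Proof.
rewrite -natr_sum; congr _%:R; elim: (n) => [|p IHp].
  by rewrite big_ord0 minn0.
rewrite big_ord_recr /= IHp; case: (ltnP p m) => pm.
  by rewrite !(minn_idPr _) ?addn1 // ltnW.
by rewrite !(minn_idPl _) ?addn0 // leqW.
Qed.

(** The sum is [e_i0] times the indicator of [j < m], so it is tested against
    [e_i0] and the normalized indicator. *)
Lemma bilinear_sum_delta_rowmx (q : C) : 0 < q -> q ^+ 2 = (minn m n)%:R ->
  exists x y, [/\ x \is unitarymx, y \is unitarymx
    & (x *m (\sum_(k < m) delta_rowmx k) *m y ^t*) 0 0 = q].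
Proof.
move=> q0 q2; have qn0 : q != 0 by rewrite gt_eqF.
exists (delta_mx 0 i0), (\row_j ((j < m)%N%:R / q)); split.
- exact: delta_unit_row.
- rewrite unit_row_normE.
  have yE (j : 'I_n) : `|(\row_j ((j < m)%N%:R / q)) 0 j| ^+ 2 = (j < m)%N%:R / q ^+ 2.
    rewrite mxE normrM normr_nat ger0_norm ?invr_ge0 ?(ltW q0) // exprMn.
    by rewrite -natrX exprVn; case: (j < m)%N.
  rewrite (eq_bigr _ (fun j _ => yE j)) -mulr_suml sum_ltn_ord -q2.
  by rewrite divff // expf_neq0.
rewrite -rowE mxE.
transitivity (\sum_(j < n) (j < m)%N%:R / q).
  apply: eq_bigr => j _; rewrite !mxE summxE.
  under eq_bigr do rewrite mxE.
  rewrite sum_nat_eq_ord eqxx /= rmorphM rmorph_nat fmorphV /=.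
  rewrite geC0_conj ?ltW // mulrA -natrM mulnb andbb //.
by rewrite -mulr_suml sum_ltn_ord -q2 expr2 mulfK.
Qed.

End Extremal.

(** * The operator norm *)

Section OperatorNorm.
Local Open Scope classical_set_scope.
Context {R : realType} {n : nat}.
Context (i0 : 'I_n).
Implicit Types (Z : 'M[R[i]]_n) (x y : 'rV[R[i]]_n).

Lemma normcE (z : R[i]) : `|z| = (ComplexField.Normc.normc z)%:C.
Proof. by []. Qed.

Definition opnorm Z : R :=
  sup [set r | exists x y, [/\ x \is unitarymx, y \is unitarymx
    & r%:C = `|(x *m Z *m y ^t*) 0 0|]].

(** The supremum is finite because the entries of unit vectors are at most
    [1] in absolute value. *)
Lemma opnorm_ge x y Z : x \is unitarymx -> y \is unitarymx ->
  `|(x *m Z *m y ^t*) 0 0| <= (opnorm Z)%:C.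
Proof.
move=> x1 y1; rewrite normcE lecR; apply: ub_le_sup; last by exists x, y.
exists (complex.Re (\sum_j \sum_i `|Z i j|)) => r [x' [y' [x'1 y'1 rE]]].
have := bilinear_le_sum_entries Z x'1 y'1.
by rewrite -rE lecE => /andP[].
Qed.

Lemma opnorm_le c Z : (forall x y, x \is unitarymx -> y \is unitarymx ->
  `|(x *m Z *m y ^t*) 0 0| <= c%:C) -> opnorm Z <= c.
Proof.
move=> H; apply: ge_sup.
  pose e : 'rV[R[i]]_n := delta_mx 0 i0; have e1 := delta_unit_row i0.
  exists (ComplexField.Normc.normc ((e *m Z *m e ^t*) 0 0)).
  by exists e, e; split; [exact: e1|exact: e1|].
by move=> r [x [y [x1 y1 rE]]]; rewrite -lecR rE H.
Qed.

Lemma opnorm_ge0 Z : 0 <= opnorm Z.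
Proof.
have e1 := delta_unit_row i0.
by rewrite -ler0c; apply: le_trans (opnorm_ge Z (e1 _) (e1 _)).
Qed.

Lemma opnormZ_le (a : R[i]) Z :
  opnorm (a *: Z) <= ComplexField.Normc.normc a * opnorm Z.
Proof.
apply: opnorm_le => x y x1 y1.
have -> : (ComplexField.Normc.normc a * opnorm Z)%:C = `|a| * (opnorm Z)%:C.
  by rewrite normcE -rmorphM.
by rewrite -scalemxAr -scalemxAl mxE normrM ler_wpM2l // opnorm_ge.
Qed.

Lemma opnormU_le Z U V : U \is unitarymx -> V \is unitarymx ->
  opnorm (U *m Z *m V) <= opnorm Z.
Proof.
move=> Uu Vu; apply: opnorm_le => x y x1 y1.
have -> : x *m (U *m Z *m V) *m y ^t* = (x *m U) *m Z *m (y *m V ^t*) ^t*.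
  by rewrite trmx_mul map_mxM trmxCK !mulmxA.
exact: (opnorm_ge Z (mul_unitarymx x1 Uu)
                    (mul_unitarymx y1 (unitarymx_adj Vu))).
Qed.

Lemma opnorm_unitarily_invariant_norm : unitarily_invariant_norm opnorm.
Proof.
split; first split.
- exact: opnorm_ge0.
- move=> Z Z0; apply/matrixP => i j; rewrite mxE.
  have := opnorm_ge Z (delta_unit_row i) (delta_unit_row j).
  rewrite Z0 -rowE trmx_delta map_delta_mx -colE !mxE normr_le0.
  by move=> /eqP.
- move=> a Z; apply/eqP; rewrite eq_le opnormZ_le /=.
  have [->|a0] := eqVneq a 0.
    by rewrite ComplexField.Normc.normc0 mul0r opnorm_ge0.
  have na0 : 0 < ComplexField.Normc.normc a.
    by rewrite -ltcR -normcE normr_gt0.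
  (* The reverse inequality is [opnormZ_le] for the scalar [a^-1]. *)
  rewrite mulrC -ler_pdivlMr // mulrC -ComplexField.Normc.normcV.
  by rewrite -{1}[Z](scalerK a0) opnormZ_le.
- move=> Y Z; apply: opnorm_le => x y x1 y1.
  rewrite mulmxDr mulmxDl mxE rmorphD (le_trans (ler_normD _ _)) //.
  by rewrite lerD // opnorm_ge.
move=> Z U V Uu Vu; have UZV := opnormU_le Z Uu Vu.
apply/le_anti/andP; split; first exact: UZV.
have {1}-> : Z = U ^t* *m (U *m Z *m V) *m V ^t*.
  rewrite !mulmxA (mulmx1C (unitarymxP Uu)) mul1mx.
  by rewrite -mulmxA (unitarymxP Vu) mulmx1.
exact: (opnormU_le _ (unitarymx_adj Uu) (unitarymx_adj Vu)).
Qed.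

Lemma delta_rowmx_sharp m (c : R) : (0 < m)%N ->
  opnorm (\sum_(k < m) delta_rowmx i0 k)
    <= c * opnorm (\sum_(k < m) absmx (delta_rowmx i0 k)) ->
  Num.sqrt (minn m n)%:R <= c.
Proof.
move=> m0; set q : R := Num.sqrt _.
have n0 : (0 < n)%N by apply: leq_ltn_trans (ltn_ord i0).
have q0 : 0 < q by rewrite sqrtr_gt0 ltr0n leq_min m0.
have q2 : (q%:C) ^+ 2 = (minn m n)%:R :> R[i].
  by rewrite -rmorphXn sqr_sqrtr // rmorph_nat.
have Q1 : opnorm (\sum_(k < m) absmx (delta_rowmx i0 k)) <= 1.
  apply: opnorm_le => x y x1 y1.
  exact: (bilinear_sum_absmx_delta_rowmx_le1 i0 m x1 y1).
have Tq : q <= opnorm (\sum_(k < m) delta_rowmx i0 k).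
  have [|x [y [x1 y1 xy]]] := @bilinear_sum_delta_rowmx _ _ i0 m (q%:C) _ q2.
    by rewrite ltcR.
  have := opnorm_ge (\sum_(k < m) delta_rowmx i0 k) x1 y1.
  by rewrite xy ger0_norm ?ler0c ?lecR // ltW.
move=> Tc; have {}Tc := le_trans Tq Tc.
have c0 : 0 < c.
  rewrite ltNge; apply/negP => c0; have := lt_le_trans q0 Tc.
  by rewrite ltNge (mulr_le0_ge0 c0 (opnorm_ge0 _)).
exact: le_trans Tc (ler_piMr (ltW c0) Q1).
Qed.

End OperatorNorm.

Theorem theorem1p7 (R : realType) (m n : nat) (hm : (2 <= m)%N) (hn : (2 <= n)%N) :
  (forall N : 'M[R[i]]_n -> R, unitarily_invariant_norm N ->
     forall A : 'I_m -> 'M[R[i]]_n,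
       N (\sum_(k < m) A k)
         <= Num.sqrt (minn m n)%:R * N (\sum_(k < m) absmx (A k)))
  /\
  (forall c : R,
     (forall N : 'M[R[i]]_n -> R, unitarily_invariant_norm N ->
        forall A : 'I_m -> 'M[R[i]]_n,
          N (\sum_(k < m) A k) <= c * N (\sum_(k < m) absmx (A k))) ->
     Num.sqrt (minn m n)%:R <= c).
Proof.
have m0 : (0 < m)%N by apply: leq_trans hm.
have n0 : (0 < n)%N by apply: leq_trans hn.
split=> [N uiN A|c Hc]; first exact: ui_sum_le.
apply: (delta_rowmx_sharp (i0 := Ordinal n0) m0); apply: Hc.
exact: (opnorm_unitarily_invariant_norm (Ordinal n0)).
Qed.
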